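(* Let $X\in\mathbb{R}^{n\times m}$ ($n\ge m$) be a matrix with full column rank, let $k$ be an integer with $m\le k\le n$, and let $1\le\ell\le m$. Let $S$ be a random subset of $\{1,\dots,n\}$ of size $k$ drawn with probability $$\mathcal{P}(S)=\frac{\det(X_S^\top X_S)}{\sum_{T\subseteq\{1,\dots,n\},\,|T|=k}\det(X_T^\top X_T)}.$$ Then $$\mathbb{E}_{S\sim\mathcal{P}}\Bigl[E_\ell\bigl((X_S^\top X_S)^{-1}\bigr)\Bigr]\le\prod_{i=1}^{\ell}\frac{n-m+i}{k-m+i}\cdot E_\ell\bigl((X^\top X)^{-1}\bigr),$$ with equality if $X_S^\top X_S\succ0$ for all subsets $S$ of size $k$.
   Context: $X_S$ denotes the $|S|\times m$ matrix formed by the rows of $X$ indexed by $S$. For a symmetric $m\times m$ matrix $M$ with eigenvalues $\lambda_1,\dots,\lambda_m$, $E_\ell(M)=\sum_{I\subseteq\{1,\dots,m\},\,|I|=\ell}\prod_{j\in I}\lambda_j$. Sets $S$ for which $X_S^\top X_S$ is singular have probability $0$ and contribute $0$ to the expectation. *)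

(* Defs.v *)
From HB Require Import structures.
From mathcomp Require Import all_boot all_order all_algebra.
From mathcomp Require Import boolp classical_sets reals.
From mathcomp Require Import complex.

Set Implicit Arguments.
Unset Strict Implicit.
Unset Printing Implicit Defensive.

Import Order.TTheory GRing.Theory Num.Theory.
Local Open Scope ring_scope.

Section Defs.
Variable R : realType.

(** X_S, with the rows kept in increasing order of their indices. *)
Definition rowsel n m (X : 'M[R]_(n, m)) (S : {set 'I_n}) : 'M[R]_(#|S|, m) :=
  rowsub (fun i : 'I_#|S| => enum_val i) X.

Definition gram n m (X : 'M[R]_(n, m)) : 'M[R]_m := X^T *m X.

Definition posdefmx m (M : 'M[R]_m) : Prop :=
  M^T = M /\ forall v : 'cV[R]_m, v != 0 -> 0 < (v^T *m M *m v) 0 0.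

(** [lambda] lists the eigenvalues of [M] with algebraic multiplicity. *)
Definition eigenvalues_of m (M : 'M[R]_m) (lambda : 'rV[R]_m) : Prop :=
  char_poly M = \prod_(j < m) ('X - (lambda 0 j)%:P).

(** Such a list is unique up to reordering, and exists when [M] is symmetric
    ([eigvalsP] below); otherwise the value is irrelevant. *)
Definition eigvals m (M : 'M[R]_m) : 'rV[R]_m :=
  xget 0 [set lambda | eigenvalues_of M lambda]%classic.

Definition E_ l m (M : 'M[R]_m) : R :=
  \sum_(I : {set 'I_m} | #|I| == l) \prod_(j in I) eigvals M 0 j.

Definition volprob n m (X : 'M[R]_(n, m)) (k : nat) (S : {set 'I_n}) : R :=
  \det (gram (rowsel X S)) /
  \sum_(T : {set 'I_n} | #|T| == k) \det (gram (rowsel X T)).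

(** Expectation of [f S] for [S] drawn among the [k]-subsets with probability
    [volprob X k S].  When [gram (rowsel X S)] is singular, [volprob X k S] is 0,
    so that the (default) value of [f S] plays no role. *)
Definition volexpect n m (X : 'M[R]_(n, m)) (k : nat) (f : {set 'I_n} -> R) : R :=
  \sum_(S : {set 'I_n} | #|S| == k) volprob X k S * f S.

Lemma char_poly_simil (C : fieldType) m (P D : 'M[C]_m) : P \in unitmx ->
  char_poly (invmx P *m D *m P) = char_poly D.
Proof.
move=> Pu; rewrite /char_poly /char_poly_mx.
have VK : map_mx polyC (invmx P) *m map_mx polyC P = 1%:M.
  by rewrite -map_mxM mulVmx // map_mx1.
have -> : 'X%:M - map_mx polyC (invmx P *m D *m P) =
  map_mx polyC (invmx P) *m ('X%:M - map_mx polyC D) *m map_mx polyC P.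
  rewrite !map_mxM mulmxBr mulmxBl scalar_mxC.
  by rewrite -[_%:M *m _ *m _]mulmxA VK mulmx1.
by rewrite !det_mulmx mulrAC -det_mulmx VK det1 mul1r.
Qed.

Lemma eigvalsP m (M : 'M[R]_m) : M^T = M -> eigenvalues_of M (eigvals M).
Proof.
move=> Msym; apply: (@xgetPex _ 0 [set lambda | eigenvalues_of M lambda]%classic).
pose f := real_complex R.
pose A := map_mx f M.
have realf x : (f x)^*%C = f x by rewrite conjc_real.
have Ah : A \is hermsymmx.
  apply/is_hermitianmxP; rewrite expr0 scale1r /A; apply/matrixP => i j.
  by rewrite !mxE -[in LHS]Msym mxE [RHS]realf.
have /orthomx_spectralP AE := hermitian_normalmx Ah.
have := hermitian_spectral_diag_real Ah.
set d := spectral_diag A in AE * => /mxOverP dreal.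
exists (map_mx (@complex.Re R) d) => /=; rewrite /eigenvalues_of.
apply: (map_poly_inj f); rewrite map_char_poly -/A AE.
rewrite char_poly_simil ?spectral_unit // char_poly_trig ?diag_mx_is_trig //.
rewrite rmorph_prod; apply: eq_bigr => i _.
rewrite rmorphB /= map_polyX map_polyC /= !mxE eqxx mulr1n.
by rewrite /f RRe_real.
Qed.

End Defs.

(* Main.v *)
(** Up to sign, the coefficient [c_l(S)] of ['X^l] in the characteristic
    polynomial [p_S] of [X_S^T X_S] is its elementary symmetric function of
    degree [m - l], which is nonnegative, and equals [det (X_S^T X_S)] times
    [E_l ((X_S^T X_S)^-1)] when [X_S^T X_S] is invertible.  Deleting a row is a
    rank one update, so the matrix determinant lemma and Jacobi's formula give
    [\sum_(i in S) p_(S \ i) = (#|S| - m) p_S + 'X p_S'].  Double counting then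
    yields [\sum_(#|S| = k) c_l(S) = 'C(n - m + l, k - m + l) c_l([n])].  The
    normalising constant is the case [l = 0], and the inequality is strict
    exactly through the singular [S], which contribute [0] instead of
    [c_l(S) >= 0]. *)
Require Import Defs.
From mathcomp Require Import all_boot all_order all_algebra.
From mathcomp Require Import reals.
From mathcomp Require Import ring zify.

Import Order.TTheory GRing.Theory Num.Theory.
Local Open Scope ring_scope.

(** * Derivatives of determinants and of the characteristic polynomial *)

Lemma deriv_prod (F : comNzRingType) (I : finType) (p : I -> {poly F}) :
  (\prod_i p i)^`() = \sum_i (p i)^`() * \prod_(j | j != i) p j.
Proof.
suff H (r : seq I) : uniq r -> (\prod_(i <- r) p i)^`() =
    \sum_(i <- r) (p i)^`() * \prod_(j <- r | j != i) p j.
  by rewrite H // index_enum_uniq.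
elim: r => [_|a r IHr] /=; first by rewrite !big_nil derivC.
case/andP=> ar ur; rewrite !big_cons derivM (IHr ur) eqxx /=.
have -> : \prod_(j <- r | j != a) p j = \prod_(j <- r) p j.
  rewrite big_seq_cond [RHS]big_seq_cond; apply: eq_bigl => j.
  by case jr: (j \in r) => //=; apply: contraNneq ar => <-.
congr (_ + _); rewrite mulr_sumr; apply: eq_big_seq => i ir.
rewrite big_cons; have -> : a != i by apply: contraNneq ar => ->.
by rewrite mulrCA.
Qed.

Lemma deriv_det (F : comNzRingType) (m : nat) (A : 'M[{poly F}]_m) :
  (\det A)^`() = \sum_i \sum_j (A i j)^`() * cofactor A i j.
Proof.
(* [B i] differentiates row [i] only, which the cofactors along that row do not see. By the Leibniz
   formula the derivative is the sum of the [\det (B i)]. *)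
pose B i := \matrix_(a, b) (if a == i then (A a b)^`() else A a b).
have cofB i j : cofactor A i j = cofactor (B i) i j.
  congr (_ * \det _); apply/matrixP=> a b; rewrite !mxE.
  by rewrite -if_neg eq_sym neq_lift.
transitivity (\sum_i \det (B i)); last first.
  apply: eq_bigr => i _; rewrite (expand_det_row _ i); apply: eq_bigr => j _.
  by rewrite mxE eqxx cofB.
rewrite /determinant raddf_sum /= exchange_big; apply: eq_bigr => s _ /=.
have sign' (b : bool) : ((-1) ^+ b : {poly F})^`() = 0.
  by case: b; rewrite ?expr0 ?expr1 ?derivN derivC ?oppr0.
rewrite -mulr_sumr derivM sign' mul0r add0r deriv_prod.
congr (_ * _); apply: eq_bigr => i _.
rewrite [RHS](bigD1 i) //= mxE eqxx; congr (_ * _).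
by apply: eq_bigr => j /negPf ji; rewrite mxE ji.
Qed.

(** The entrywise derivative of [char_poly_mx M] is the identity, so Jacobi's formula keeps only the
    diagonal cofactors. *)
Lemma deriv_char_poly (F : comNzRingType) (m : nat) (M : 'M[F]_m) :
  (char_poly M)^`() = \tr (\adj (char_poly_mx M)).
Proof.
rewrite deriv_det /mxtrace; apply: eq_bigr => i _.
rewrite (bigD1 i) //= big1 ?addr0 => [|j ji].
  by rewrite !mxE eqxx mulr1n derivB derivX derivC subr0 mul1r.
by rewrite !mxE eq_sym (negPf ji) mulr0n sub0r derivN derivC oppr0 mul0r.
Qed.

(* The block identity only gives the formula multiplied by [\det A], hence the
   cancellation hypothesis, in place of the invertibility of [A]. *)
Lemma det_rank1_update (F : idomainType) (m : nat) (A : 'M[F]_m)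
    (u : 'rV[F]_m) (v : 'cV[F]_m) : \det A != 0 ->
  \det (A + v *m u) = \det A + (u *m \adj A *m v) 0 0.
Proof.
move=> dA0.
(* Eliminating with the corner [1%:M] gives [\det N = \det (A + v *m u)]; a column operation with
   [\adj A] clears [v] instead, at the price of a factor [\det A]. *)
pose N := block_mx (1%:M : 'M_1) (- u) v A.
have detN : \det N = \det (A + v *m u).
  have : N = block_mx 1%:M 0 v 1%:M *m block_mx 1%:M (- u) 0 (A + v *m u).
    rewrite mulmx_block !(mul1mx, mul0mx, mulmx0, mulmx1, addr0) mulmxN.
    by rewrite [- _ + _]addrC addrK.
  by move->; rewrite det_mulmx det_lblock det_ublock !det1 !mul1r.
have /(congr1 determinant) :
    N *m block_mx (\det A)%:M 0 (- (\adj A *m v)) 1%:M =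
    block_mx ((\det A)%:M + u *m \adj A *m v) (- u) 0 A.
  rewrite mulmx_block !(mul1mx, mul0mx, mulmx0, mulmx1, add0r).
  rewrite mulNmx !mulmxN opprK !mulmxA mul_mx_adj mul_mx_scalar mul_scalar_mx.
  by rewrite addrN.
rewrite det_mulmx det_lblock det_ublock det1 mulr1 detN.
rewrite !det_mx11 !mxE eqxx mulr1n.
exact: mulIf.
Qed.

(** Each [S] of size [k] arises as [T :\ i] once for every [i] outside [S]. *)
Lemma sum_subsets_setD1 (V : nmodType) (n k : nat) (f : {set 'I_n} -> V) :
  \sum_(T : {set 'I_n} | #|T| == k.+1) \sum_(i in T) f (T :\ i) =
  (\sum_(S : {set 'I_n} | #|S| == k) f S) *+ (n - k).
Proof.
rewrite (exchange_big_dep predT) //=.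
transitivity (\sum_i \sum_(S : {set 'I_n} | (#|S| == k) && (i \notin S)) f S).
  apply: eq_bigr => i _.
  rewrite (reindex_onto (fun S => i |: S) (fun T => T :\ i)) /=; last first.
    by move=> T /andP[_ iT]; rewrite setD1K.
  have D1E S : ((i |: S) :\ i == S) = (i \notin S).
    apply/eqP/idP => [<-|iS]; first by rewrite !inE eqxx.
    by rewrite setU1K.
  apply: eq_big => [S|S /andP[_ /eqP->] //].
  rewrite D1E setU11 andbT cardsU1.
  by case: (i \in S); rewrite ?andbF //= add1n eqSS.
rewrite (exchange_big_dep (fun S : {set 'I_n} => #|S| == k)) /=; last first.
  by move=> i S _ /andP[].
rewrite -sumrMnl; apply: eq_bigr => S /eqP cS.
rewrite (eq_bigl [in ~: S]); last by move=> i; rewrite inE cS eqxx.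
by rewrite sumr_const cardsCs setCK cS card_ord.
Qed.

(** * Coefficients and roots of the characteristic polynomial *)

Lemma coef_prod_XsubC (F : comNzRingType) (m l : nat) (a : 'I_m -> F) :
  (-1) ^+ (m + l) * (\prod_j ('X - (a j)%:P))`_l =
  \sum_(J : {set 'I_m} | #|J| == l) \prod_(j | j \notin J) a j.
Proof.
(* [J] collects the factors that contribute ['X]. When [#|J| = l], the others give the sign
   [(-1) ^+ (m - l)], cancelled by [(-1) ^+ (m + l)]. *)
have -> : \prod_j ('X - (a j)%:P) = \sum_(J : {set 'I_m})
    (\prod_(j | j \notin J) - a j)%:P * 'X^#|J|.
  rewrite (bigA_distr _ _ (fun=> 'X) (fun j => - (a j)%:P)).
  apply: eq_bigr => J _; rewrite (bigID [in J]) /= mulrC rmorph_prod -prodr_const.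
  congr (_ * _); apply: eq_bigr => i; last by move=> ->.
  by move=> /negPf ->; rewrite rmorphN.
rewrite coef_sum mulr_sumr [RHS]big_mkcond; apply: eq_bigr => J _ /=.
rewrite coefCM coefXn eq_sym; case: eqP => [cJ|_]; last by rewrite !mulr0.
rewrite mulr1 prodrN mulrA -exprD -cJ.
have -> : #|[pred j | j \notin J]| = #|~: J| by apply: eq_card => j; rewrite !inE.
rewrite -addnA cardsC card_ord -signr_odd addnn odd_double expr0 mul1r.
by apply: eq_bigl.
Qed.

(** In characteristic zero the points 1, 2, ... are distinct and nonzero, so they provide enough
    roots of [p - q]. *)
Lemma eq_poly_horner_neq0 (F : numFieldType) (p q : {poly F}) :
  (forall t, t != 0 -> p.[t] = q.[t]) -> p = q.
Proof.
move=> pq; apply/eqP; rewrite -subr_eq0; apply/eqP.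
apply: (@roots_geq_poly_eq0 _ _ [seq i.+1%:R | i <- iota 0 (size (p - q)%R)]).
- apply/allP => _ /mapP[i _ ->].
  by rewrite rootE hornerD hornerN pq ?pnatr_eq0 // subrr.
- rewrite map_inj_uniq ?iota_uniq // => i j /eqP.
  by rewrite eqr_nat eqSS => /eqP.
- by rewrite size_map size_iota.
Qed.

Lemma horner_char_poly (F : comNzRingType) (m : nat) (M : 'M[F]_m) (t : F) :
  (char_poly M).[t] = \det (t%:M - M).
Proof.
rewrite -[LHS]/(horner_eval t _) -det_map_mx; congr (\det _).
apply/matrixP => i j; rewrite !mxE rmorphB rmorphMn /=.
by rewrite /horner_eval hornerX hornerC.
Qed.

(** [eigvals] chooses a list for each matrix separately, so those of a matrix and of its inverse
    cannot be matched by index; a factorisation is carried over instead. *)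
Lemma char_poly_of_invmx (F : numFieldType) (m : nat) (M : 'M[F]_m)
    (a : 'I_m -> F) : M \in unitmx ->
  char_poly (invmx M) = \prod_j ('X - (a j)%:P) ->
  char_poly M = \prod_j ('X - (a j)^-1%:P).
Proof.
move=> Mu chV.
have ev t : \det (t%:M - invmx M) = \prod_j (t - a j).
  rewrite -horner_char_poly chV horner_prod.
  by apply: eq_bigr => j _; rewrite hornerXsubC.
have detV : (\det M)^-1 = \prod_j a j.
  (* This is [ev] at [t = 0], up to the sign [(-1) ^+ m]. *)
  rewrite -det_inv; apply: (@mulfI _ ((-1) ^+ m)); first by rewrite signr_eq0.
  rewrite -detZ scaleN1r -[- _]sub0r -(raddf0 (@scalar_mx F m)) ev.
  by under eq_bigr do rewrite sub0r; rewrite prodrN card_ord.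
have a0 j : a j != 0.
  have : \prod_j a j != 0 by rewrite -detV invr_eq0 -unitfE -unitmxE.
  by move=> /prodf_neq0; apply.
apply: eq_poly_horner_neq0 => t t0; rewrite horner_char_poly horner_prod.
(* The value at [t] is reduced to the one given by [ev] at [t^-1], whence [t != 0]. *)
have -> : t%:M - M = M *m (- t *: (t^-1%:M - invmx M)).
  rewrite -scalemxAr mulmxBr mul_mx_scalar mulmxV // scalerBr scalerA.
  by rewrite mulNr divff // scaleN1r scaleNr opprK scalemx1 addrC.
rewrite det_mulmx detZ ev -[\det M]invrK detV -prodfV -[m in _ ^+ m]card_ord.
rewrite -prodr_const -!big_split; apply: eq_bigr => j _ /=.
by rewrite hornerXsubC; field; rewrite t0 a0.
Qed.

Lemma coef0_char_poly (F : comNzRingType) (m : nat) (M : 'M[F]_m) :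
  (-1) ^+ m * (char_poly M)`_0 = \det M.
Proof. by rewrite char_poly_det mulrA -expr2 sqrr_sign mul1r. Qed.

Lemma coef_char_poly_E (R : realType) (m l : nat) (M : 'M[R]_m) :
  M^T = M -> M \in unitmx ->
  (-1) ^+ (m + l) * (char_poly M)`_l = \det M * E_ l (invmx M).
Proof.
move=> Msym Mu; have VMsym : (invmx M)^T = invmx M by rewrite trmx_inv Msym.
have chM := char_poly_of_invmx _ _ _ _ Mu (eigvalsP VMsym).
have detM : \det M = \prod_j (eigvals (invmx M) 0 j)^-1.
  rewrite -coef0_char_poly -[X in _ ^+ X]addn0 chM.
  rewrite coef_prod_XsubC (big_pred1 set0) => [|J].
    by apply: eq_bigl => j; rewrite inE.
  by rewrite cards_eq0.
have a0 j : eigvals (invmx M) 0 j != 0.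
  have : \det M != 0 by rewrite -unitfE -unitmxE.
  by rewrite detM => /prodf_neq0/(_ j isT); rewrite invr_eq0.
rewrite chM coef_prod_XsubC detM /E_ mulr_sumr; apply: eq_bigr => J _.
(* [\det M] is the product of all the inverses of the eigenvalues of [invmx M]; the factors indexed
   by [J] cancel. *)
rewrite [X in _ = X * _](bigID [in J]) /= mulrAC -big_split /=
  [X in X * _]big1 ?mul1r // => j _.
by rewrite mulVf.
Qed.

(** * Gram matrices of sets of rows *)

Section Gram.
Variables (R : realType) (n m : nat) (X : 'M[R]_(n, m)).
Implicit Type S : {set 'I_n}.

(** Trades the enumeration of [S] inside [rowsel] for rank one terms, so that deleting a row removes
    one term. *)
Lemma gram_rowsel S :
  gram (rowsel X S) = \sum_(i in S) (row i X)^T *m row i X.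
Proof.
apply/matrixP => a b; rewrite summxE mxE.
rewrite (big_enum_val (fun i => ((row i X)^T *m row i X) a b)) /=.
by apply: eq_bigr => i _; rewrite [RHS]mxE big_ord1 !mxE.
Qed.

Lemma gram_rowsel_setT : gram (rowsel X [set: 'I_n]) = gram X.
Proof.
rewrite gram_rowsel; apply/matrixP => a b; rewrite summxE mxE.
apply: eq_big => [i|i _]; first by rewrite inE.
by rewrite mxE big_ord1 !mxE.
Qed.

Lemma sum_char_poly_gram_setD1 S :
  \sum_(i in S) char_poly (gram (rowsel X (S :\ i))) =
  (#|S|%:R - m%:R) * char_poly (gram (rowsel X S))
    + 'X * (char_poly (gram (rowsel X S)))^`().
Proof.
set G := gram _; pose A := char_poly_mx G.
(* The determinant is a monic polynomial, hence nonzero even when [G] is singular. *)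
have dA0 : \det A != 0 by apply/monic_neq0/char_poly_monic.
pose x i : 'rV[{poly R}]_m := map_mx polyC (row i X).
have del i : i \in S -> char_poly (gram (rowsel X (S :\ i))) =
    \det A + \tr (\adj A *m ((x i)^T *m x i)).
  move=> iS; rewrite mulmxA [\tr _]mxtrace_mulC [\tr _]big_ord1 mulmxA.
  rewrite -det_rank1_update //; congr (\det _).
  rewrite /A /char_poly_mx /G !gram_rowsel [in RHS](bigD1 i) //=.
  rewrite map_mxD map_mxM map_trmx -/(x i) opprD addrA addrAC subrK.
  by congr (_ - map_mx _ _); apply: eq_bigl => j; rewrite !inE andbC.
rewrite (eq_bigr _ del) big_split /= sumr_const -raddf_sum /= -mulmx_sumr.
(* The rank one terms add up to [G] over the polynomials, and [\adj A *m ('X%:M - A)] is ['X] times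
   [\adj A] minus the scalar matrix [\det A]. *)
have -> : \sum_(i in S) (x i)^T *m x i = 'X%:M - A.
  rewrite /A /char_poly_mx subKr /G gram_rowsel map_mx_sum.
  by apply: eq_bigr => i _; rewrite map_mxM map_trmx.
rewrite mulmxBr mul_adj_mx mul_mx_scalar raddfB /= mxtraceZ mxtrace_scalar.
rewrite deriv_char_poly -/A /char_poly -/A.
move: (\det A) (\tr _) => a b.
rewrite -(mulr_natl a m) -(mulr_natl a #|S|).
by ring.
Qed.

(** ['X p'] multiplies the coefficient of ['X^l] by [l], so the recursion acts on each coefficient
    separately. *)
Lemma sum_coef_char_poly_gram_setD1 l S :
  \sum_(i in S) (char_poly (gram (rowsel X (S :\ i))))`_l =
  (#|S|%:R - m%:R + l%:R) * (char_poly (gram (rowsel X S)))`_l.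
Proof.
rewrite -coef_sum sum_char_poly_gram_setD1 coefD coefXM coef_deriv.
rewrite mulrBl -!polyC_natr coefB !coefCM -mulrBl.
case: l => [|l] /=; first by ring.
by move: (_`_ _) => a; rewrite -[a *+ _]mulr_natl; ring.
Qed.

Lemma sum_coef_char_poly_gram k l : (m <= k)%N -> (k <= n)%N ->
  \sum_(S : {set 'I_n} | #|S| == k) (char_poly (gram (rowsel X S)))`_l =
  'C(n - m + l, k - m + l)%:R * (char_poly (gram X))`_l.
Proof.
move=> le_mk le_kn.
(* Downward induction on [k], starting from the full set at [k = n]. *)
elim: {k}(n - k)%N {-2}k (erefl (n - k)%N) le_mk le_kn =>
  [|d IHd] k dk le_mk le_kn.
  have -> : k = n by lia.
  rewrite binn mul1r (big_pred1 [set: 'I_n]) ?gram_rowsel_setT // => S.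
  rewrite /= eqEcard subsetT cardsT card_ord eqn_leq.
  by have := max_card (mem S); rewrite card_ord => ->.
have nk0 : (n - k)%:R != 0 :> R by rewrite pnatr_eq0; lia.
apply: (mulfI nk0); rewrite [LHS]mulr_natl.
have /= <- := sum_subsets_setD1 _ _ k (fun S => (char_poly (gram (rowsel X S)))`_l).
rewrite (eq_bigr (fun T => (k.+1%:R - m%:R + l%:R) *
    (char_poly (gram (rowsel X T)))`_l)) => [|T /eqP <-]; last first.
  exact: sum_coef_char_poly_gram_setD1.
rewrite -mulr_sumr IHd; [|lia..].
rewrite !mulrA; congr (_ * _); rewrite -natrB -?natrD -?natrM; last by lia.
congr (_%:R); have := mul_bin_left (n - m + l) (k - m + l).
have -> : (k.+1 - m + l = (k - m + l).+1)%N by lia.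
by have -> : (n - m + l - (k - m + l) = n - k)%N by lia.
Qed.

Lemma gram_sym : (gram X)^T = gram X.
Proof. by rewrite /gram trmx_mul trmxK. Qed.

Lemma dotmx_self_ge0 (v : 'rV[R]_n) : 0 <= (v *m v^T) 0 0.
Proof. by rewrite mxE sumr_ge0 // => i _; rewrite mxE -expr2 sqr_ge0. Qed.

Lemma dotmx_self_eq0 (v : 'rV[R]_n) : (v *m v^T) 0 0 = 0 -> v = 0.
Proof.
rewrite mxE => v0; apply/matrixP => i j; rewrite ord1 mxE.
have /psumr_eq0P H : forall i, true -> 0 <= v 0 i * v^T i 0.
  by move=> a _; rewrite mxE -expr2 sqr_ge0.
by move: (H v0 j isT) => /eqP; rewrite mxE -expr2 sqrf_eq0 => /eqP.
Qed.

Lemma gram_form (v : 'rV[R]_m) : v *m gram X *m v^T = (v *m X^T) *m (v *m X^T)^T.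
Proof. by rewrite /gram trmx_mul trmxK !mulmxA. Qed.
End Gram.

(** * Positivity and invertibility *)

Lemma eigvals_gram_ge0 (R : realType) (n m : nat) (X : 'M[R]_(n, m)) (j : 'I_m) :
  0 <= eigvals (gram X) 0 j.
Proof.
have /eigenvalueP[v /(congr1 (mulmx^~ v^T)) vG v0] :
    eigenvalue (gram X) (eigvals (gram X) 0 j).
  rewrite eigenvalue_root_char (eigvalsP (gram_sym _ _ _ X)) (bigD1 j) //=.
  by rewrite rootM root_XsubC eqxx.
have vv : 0 < (v *m v^T) 0 0.
  rewrite lt_def dotmx_self_ge0 andbT.
  by apply: contraNneq v0 => /dotmx_self_eq0 ->.
rewrite -(pmulr_lge0 _ vv).
(* For a row eigenvector [v], the eigenvalue times the squared norm of [v] is the squared norm of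
   [v *m X^T]. *)
have -> : eigvals (gram X) 0 j * (v *m v^T) 0 0 = (v *m gram X *m v^T) 0 0.
  by rewrite vG -scalemxAl [RHS]mxE.
by rewrite gram_form dotmx_self_ge0.
Qed.

Lemma coef_char_poly_gram_ge0 (R : realType) (n m l : nat) (X : 'M[R]_(n, m)) :
  0 <= (-1) ^+ (m + l) * (char_poly (gram X))`_l.
Proof.
rewrite (eigvalsP (gram_sym _ _ _ X)) coef_prod_XsubC.
by apply: sumr_ge0 => J _; apply: prodr_ge0 => j _; apply: eigvals_gram_ge0.
Qed.

Lemma gram_unitmx (R : realType) (n m : nat) (X : 'M[R]_(n, m)) :
  \rank X = m -> gram X \in unitmx.
Proof.
move=> rankX; rewrite unitmxE unitfE; apply/det0P => -[v v0 vG].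
have /dotmx_self_eq0 vX : ((v *m X^T) *m (v *m X^T)^T) 0 0 = 0.
  by rewrite -gram_form vG mul0mx mxE.
have /row_free_inj inj : row_free X^T by rewrite /row_free mxrank_tr rankX.
by move/eqP: v0; apply; apply: (inj 1%N); rewrite vX mul0mx.
Qed.

Lemma posdefmx_unitmx (R : realType) (m : nat) (M : 'M[R]_m) :
  posdefmx M -> M \in unitmx.
Proof.
case=> _ pos; rewrite unitmxE unitfE; apply/det0P => -[v v0 vM].
have := pos v^T; rewrite trmx_eq0 => /(_ v0).
by rewrite trmxK vM mul0mx mxE ltxx.
Qed.

(** By the absorption identity, each factor raises both arguments of the binomial by one. *)
Lemma prod_ratio_bin (R : realType) (a b l : nat) :
  'C(a + l, b + l)%:R =
  (\prod_(1 <= i < l.+1) ((a + i)%:R / (b + i)%:R)) * 'C(a, b)%:R :> R.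
Proof.
elim: l => [|l IHl]; first by rewrite big_geq // !addn0 mul1r.
rewrite big_nat_recr //= mulrAC -IHl !addnS.
have b0 : (b + l).+1%:R != 0 :> R by rewrite pnatr_eq0.
apply: (mulfI b0); rewrite -natrM -mul_bin_diag natrM /=.
by rewrite [RHS]mulrCA [_ * (_ / _)]mulrC divfK // mulrC.
Qed.

Theorem lemma4p2 (R : realType) (n m k l : nat) (X : 'M[R]_(n, m))
    (le_mn : (m <= n)%N) (rankX : \rank X = m)
    (le_mk : (m <= k)%N) (le_kn : (k <= n)%N)
    (l_ge1 : (1 <= l)%N) (le_lm : (l <= m)%N) :
  let lhs := volexpect X k (fun S => E_ l (invmx (gram (rowsel X S)))) in
  let rhs := (\prod_(1 <= i < l.+1) ((n - m + i)%:R / (k - m + i)%:R))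
             * E_ l (invmx (gram X)) in
  lhs <= rhs /\
  ((forall S : {set 'I_n}, #|S| = k -> posdefmx (gram (rowsel X S))) ->
   lhs = rhs).
Proof.
move=> lhs rhs.
pose c S := (-1) ^+ (m + l) * (char_poly (gram (rowsel X S)))`_l.
pose f S := \det (gram (rowsel X S)) * E_ l (invmx (gram (rowsel X S))).
have fE S : gram (rowsel X S) \in unitmx -> f S = c S.
  by move=> u; rewrite /c coef_char_poly_E // gram_sym.
(* At a singular [S] the zero determinant kills whatever value [E_] takes at the default inverse. *)
have f_le S : f S <= c S.
  have [/fE -> //|] := boolP (gram (rowsel X S) \in unitmx).
  rewrite unitmxE unitfE negbK /f => /eqP ->.
  by rewrite mul0r coef_char_poly_gram_ge0.
have Gu := gram_unitmx _ _ _ _ rankX.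
pose b := 'C(n - m, k - m)%:R : R.
have b0 : 0 < b by rewrite ltr0n bin_gt0 leq_sub2r.
pose Z := \sum_(T : {set 'I_n} | #|T| == k) \det (gram (rowsel X T)).
have ZE : Z = b * \det (gram X).
  rewrite /Z; under eq_bigr do rewrite -coef0_char_poly.
  rewrite -mulr_sumr sum_coef_char_poly_gram // !addn0 mulrCA.
  by rewrite coef0_char_poly.
have G0 : 0 < \det (gram X).
  rewrite lt_def -unitfE -unitmxE Gu -coef0_char_poly -[X in _ ^+ X]addn0.
  exact: coef_char_poly_gram_ge0.
have Z0 : 0 < Z by rewrite ZE mulr_gt0.
have sumc : \sum_(S : {set 'I_n} | #|S| == k) c S = rhs * Z.
  rewrite -mulr_sumr sum_coef_char_poly_gram // mulrCA coef_char_poly_E //.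
    rewrite prod_ratio_bin ZE /rhs /b.
    by move: (\det _) (E_ _ _) => d e; ring.
  exact: gram_sym.
have lhsE : lhs = (\sum_(S : {set 'I_n} | #|S| == k) f S) / Z.
  rewrite mulr_suml; apply: eq_bigr => S _.
  by rewrite /volprob -/Z mulrAC.
split=> [|pd].
  by rewrite lhsE ler_pdivrMr // -sumc; apply: ler_sum => S _.
rewrite lhsE (eq_bigr c) => [|S /eqP /pd /posdefmx_unitmx /fE //].
by rewrite sumc mulfK // gt_eqF.
Qed.
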